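(* Let ${\bf d}=(d_1,\dots,d_{n+1})$ be the reduction vector of a fat point subscheme $A_0\subset\mathbb{P}^2$ with respect to some totally reducing sequence of lines $L_1,\dots,L_{n+1}$. If ${\bf d}$ is GMS, then for every $t\ge0$ $$\max(h'_0,\dots,h'_{n+1})=\binom{t-n+1}{2}+\sum_{i=0}^{n}\binom{t-i-d_{i+1}+1}{1},$$ where $h'_{n+1}=\binom{t-(n+1)+2}{2}$ and $h'_i=\binom{t-i+2}{2}-\sum_{j=i+1}^{n+1}d_j$ for $0\le i\le n$; consequently both equal $\dim_K (I_{A_0})_t$, and $h_{A_0}=f_{\bf d}=F_{\bf d}$.
   Context: Fat point schemes in $\mathbb{P}^2$ over an algebraically closed field $K$ (any characteristic), $R=K[x_0,x_1,x_2]$, $I_Z=\bigcap I_{p_i}^{m_i}$, $h_Z(t)=\dim_K(R/I_Z)_t$. Residual of $A=\sum a_ip_i$ by a line $L$: multiplicities of points on $L$ are lowered by one (not below $0$), others unchanged. A sequence of lines $L_1,\dots,L_{n+1}$ with $A_j=A_{j-1}:L_j$ totally reduces $A_0$ if $A_{n+1}=\varnothing$; its reduction vector has $d_j=$ sum of multiplicities of $A_{j-1}$ at points on $L_j$. A non-negative, non-increasing integer vector ${\bf v}=(v_1,\dots,v_r)$ is GMS if $v_i-v_j\ge j-i-1$ for all $1\le i<j\le r$. Binomial convention: $\binom{a}{k}=0$ if $a<k$. $f_{\bf v}(t)=\sum_{i=0}^{n}\binom{\min(t-i+1,v_{i+1})}{1}$, $F_{\bf v}(t)=\min_{0\le i\le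 n+1}\big(\binom{t+2}{2}-\binom{t-i+2}{2}+\sum_{j=i+1}^{n+1}v_j\big)$. *)

(* Defs.v *)
From HB Require Import structures.
From mathcomp Require Import all_boot all_order all_algebra.
Set Implicit Arguments. Unset Strict Implicit. Unset Printing Implicit Defensive.
Import Order.TTheory GRing.Theory Num.Theory.
Local Open Scope ring_scope.

(* Points of P^2 are represented by nonzero row vectors (homogeneous
   coordinates); a line is represented by a nonzero linear form l, the line
   being {p | l0 p0 + l1 p1 + l2 p2 = 0}. *)
Definition on_line (K : fieldType) (L p : 'rV[K]_3) : bool := (L *m p^T) 0 0 == 0.

(* A fat point scheme A = sum a_i p_i : a list of (point, multiplicity). *)
Definition fat_point_scheme (K : fieldType) (Z : seq ('rV[K]_3 * nat)) : Prop :=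
  (forall i, (i < size Z)%N -> (nth (0, 0%N) Z i).1 != 0) /\
  (forall i j, (i < size Z)%N -> (j < size Z)%N -> i != j ->
     forall c : K, (nth (0, 0%N) Z j).1 != c *: (nth (0, 0%N) Z i).1).

Definition lines_ok (K : fieldType) (Ls : seq 'rV[K]_3) : Prop :=
  forall j, (j < size Ls)%N -> nth 0 Ls j != 0.

Definition residual (K : fieldType) (A : seq ('rV[K]_3 * nat)) (L : 'rV[K]_3) :=
  [seq (pm.1, if on_line L pm.1 then pm.2.-1 else pm.2) | pm <- A].

Definition iter_res (K : fieldType) (A : seq ('rV[K]_3 * nat)) (Ls : seq 'rV[K]_3) :=
  foldl (@residual K) A Ls.

Definition mult_on (K : fieldType) (A : seq ('rV[K]_3 * nat)) (L : 'rV[K]_3) : nat :=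
  (\sum_(pm <- A | on_line L pm.1) pm.2)%N.

Definition totally_reduces (K : fieldType) (A : seq ('rV[K]_3 * nat)) (Ls : seq 'rV[K]_3) : Prop :=
  all (fun pm => pm.2 == 0%N) (iter_res A Ls).

(* reduction vector (0-indexed: entry j is d_{j+1}) *)
Definition red_vec (K : fieldType) (A : seq ('rV[K]_3 * nat)) (Ls : seq 'rV[K]_3) : seq nat :=
  [seq mult_on (iter_res A (take j Ls)) (nth 0 Ls j) | j <- iota 0 (size Ls)].

(* GMS vectors (non-negativity is automatic for nat) *)
Definition GMS (v : seq nat) : Prop :=
  forall i j, (i < j)%N -> (j < size v)%N ->
    (nth 0 v j <= nth 0 v i)%N /\
    (j%:Z - i%:Z - 1 <= (nth 0 v i)%:Z - (nth 0 v j)%:Z).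

(* Exponent vectors of degree-t monomials in x0,x1,x2 (a basis of R_t). *)
Definition mons (t : nat) : seq (nat * nat * nat) :=
  flatten [seq [seq (a, b, t - a - b)%N | b <- iota 0 (t - a).+1] | a <- iota 0 t.+1].

Definition alphas (m : nat) : seq (nat * nat * nat) := flatten [seq mons k | k <- iota 0 m].

(* Coefficient of the monomial x^b's contribution to the coefficient of y^al in
   the Taylor expansion x^b(p + y) = sum_al (Hasse derivative) y^al. *)
Definition hasse_coef (K : fieldType) (b al : nat * nat * nat) (p : 'rV[K]_3) : K :=
  ('C(b.1.1, al.1.1) * 'C(b.1.2, al.1.2) * 'C(b.2, al.2))%N%:R
  * p 0 0 ^+ (b.1.1 - al.1.1)%N * p 0 (inord 1) ^+ (b.1.2 - al.1.2)%N
  * p 0 (inord 2) ^+ (b.2 - al.2)%N.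

(* A form f of degree t lies in I_p^m iff f vanishes to order >= m at p,
   i.e. f(p+y) has no term y^al with |al| < m. Conditions for I_Z: *)
Definition conds (K : fieldType) (Z : seq ('rV[K]_3 * nat)) : seq ('rV[K]_3 * (nat * nat * nat)) :=
  flatten [seq [seq (pm.1, al) | al <- alphas pm.2] | pm <- Z].

(* f (coefficient row vector in the basis mons t) is in (I_Z)_t iff
   f *m condmx Z t = 0. *)
Definition condmx (K : fieldType) (Z : seq ('rV[K]_3 * nat)) (t : nat) :
  'M[K]_(size (mons t), size (conds Z)) :=
  \matrix_(k, c) hasse_coef (nth (0, 0, 0)%N (mons t) k)
                            (nth (0, (0, 0, 0)%N) (conds Z) c).2
                            (nth (0, (0, 0, 0)%N) (conds Z) c).1.

Definition dimI (K : fieldType) (Z : seq ('rV[K]_3 * nat)) (t : nat) : nat :=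
  \rank (kermx (condmx Z t)).

Definition hilb (K : fieldType) (Z : seq ('rV[K]_3 * nat)) (t : nat) : nat :=
  (size (mons t) - dimI Z t)%N.

Definition binz (a : int) (k : nat) : int :=
  if a < k%:Z then 0 else ('C(`|a|%N, k))%:Z.

(* h'_i, 0 <= i <= n+1, for d = (d_1,...,d_{n+1}) stored 0-indexed *)
Definition hp (n : nat) (d : seq nat) (t i : nat) : int :=
  binz (t%:Z - i%:Z + 2) 2 - \sum_(i <= j < n.+1) (nth 0%N d j)%:Z.

Definition hmax (n : nat) (d : seq nat) (t : nat) : int :=
  \big[Num.max/hp n d t n.+1]_(i < n.+2) hp n d t i.

Definition fv (n : nat) (v : seq nat) (t : nat) : int :=
  \sum_(i < n.+1) binz (Num.min (t%:Z - i%:Z + 1) (nth 0%N v i)%:Z) 1.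

Definition Fterm (n : nat) (v : seq nat) (t i : nat) : int :=
  binz (t%:Z + 2) 2 - binz (t%:Z - i%:Z + 2) 2 + \sum_(i <= j < n.+1) (nth 0%N v j)%:Z.

Definition Fv (n : nat) (v : seq nat) (t : nat) : int :=
  \big[Num.min/Fterm n v t n.+1]_(i < n.+2) Fterm n v t i.

(* Main.v *)
(** Multiplication by the equation of a line [L] identifies the forms of degree [t - 1] in the
    ideal of the residual [A : L] with the forms of degree [t] in the ideal of [A] that vanish
    on [L]; restriction to [L] sends the ideal of [A] to binary forms of degree [t] divisible by
    a form of degree [mult_on A L].  Iterating along the reducing lines gives
      [h'_i <= dim (I_(A_i))_(t-i) <= dim (I_A)_t <= 'C(t-n+1, 2) + \sum_i (t - i - d_i + 1)^+],
    where the first inequality is a count of conditions.  For a GMS vector the right-hand side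
    is one of the [h'_i], so all are equalities.  As [K] is infinite, forms are handled through
    their values on [K^3]. *)
Require Import Defs.
From HB Require Import structures.
From mathcomp Require Import all_boot all_order all_algebra.
From mathcomp Require Import zify ring.
Set Implicit Arguments. Unset Strict Implicit. Unset Printing Implicit Defensive.
Import Order.TTheory GRing.Theory Num.Theory.
Local Open Scope ring_scope.

Local Notation triple := (nat * nat * nat)%type.
Local Notation mon0 := ((0, 0, 0)%N : triple).

(** * Monomials of fixed and of bounded degree *)

Lemma mem_mons t (b : triple) : (b \in mons t) = (b.1.1 + b.1.2 + b.2 == t)%N.
Proof.
case: b => [[i j] k] /=; apply/flatten_mapP/eqP => [[a]|<-].
  rewrite mem_iota => ha /mapP[b]; rewrite mem_iota => hb [-> -> ->]; lia.
exists i; first by rewrite mem_iota; lia.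
by apply/mapP; exists j; [rewrite mem_iota; lia | congr (_, _, _); lia].
Qed.

Lemma big_mons (R : nmodType) t (F : triple -> R) :
  \sum_(b <- mons t) F b
  = \sum_(i < t.+1) \sum_(j < (t - i).+1) F (i : nat, j : nat, t - i - j)%N.
Proof.
rewrite big_flatten big_map -[iota 0 t.+1]/(index_iota 0 t.+1) big_mkord.
apply: eq_bigr => i _.
by rewrite big_map -[iota 0 _]/(index_iota 0 (t - i).+1) big_mkord.
Qed.

Lemma size_mons t : size (mons t) = 'C(t.+2, 2).
Proof.
rewrite -sum1_size big_mons -triangular_sum.
rewrite (eq_bigr (fun i : 'I_t.+1 => (t - i).+1)); last first.
  by move=> i _; rewrite sum1_card card_ord.
rewrite big_nat_recl // add0n big_mkord [RHS](reindex_inj rev_ord_inj) /=.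
by apply: eq_bigr => i _; rewrite subSS.
Qed.

Lemma uniq_mons t : uniq (mons t).
Proof.
pose f a : seq triple := [seq (a, b, t - a - b)%N | b <- iota 0 (t - a).+1].
have fP a b : b \in f a -> b.1.1 = a by move=> /mapP[? _ ->].
have fu a : uniq (f a).
  by rewrite map_inj_in_uniq ?iota_uniq // => x y _ _ [].
suff fs s : uniq s -> uniq (flatten (map f s)) by apply/fs/iota_uniq.
elim: s => // a s IH; rewrite cons_uniq => /andP[/negP anin us].
rewrite -[flatten _]/(f a ++ flatten (map f s)) cat_uniq fu IH // andbT.
apply/negP => /hasP[b /flatten_mapP[c cs bc] ba].
by apply: anin; rewrite -(fP _ _ ba) (fP _ _ bc).
Qed.

Lemma mem_alphas m (b : triple) : (b \in alphas m) = (b.1.1 + b.1.2 + b.2 < m)%N.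
Proof.
apply/flatten_mapP/idP => [[k]|hb].
  by rewrite mem_iota mem_mons => hk /eqP ->; lia.
by exists (b.1.1 + b.1.2 + b.2)%N; rewrite ?mem_iota ?mem_mons //; lia.
Qed.

Lemma uniq_alphas m : uniq (alphas m).
Proof.
suff fs s : uniq s -> uniq (flatten (map mons s)) by apply/fs/iota_uniq.
elim: s => // a s IH; rewrite cons_uniq => /andP[/negP anin us].
rewrite -[flatten _]/(mons a ++ flatten (map mons s)) cat_uniq uniq_mons IH // andbT.
apply/negP => /hasP[b /flatten_mapP[c cs]]; rewrite !mem_mons => /eqP bc /eqP ba.
by apply: anin; rewrite -ba bc.
Qed.

Lemma big_alphas (R : nmodType) m (F : triple -> R) :
  \sum_(b <- alphas m) F b = \sum_(j < m) \sum_(b <- mons j) F b.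
Proof. by rewrite big_flatten big_map -{1}[m]subn0 -/(index_iota 0 m) big_mkord. Qed.

(* Otherwise [/=] expands the dimensions [size (mons t)] of the row vectors below. *)
#[local] Opaque mons alphas.

(** * Forms as coefficient vectors and as functions on [K^3] *)

Section Forms.

Variable K : closedFieldType.
Implicit Types (x y p L : 'rV[K]_3) (c : K).

(** If [p] is not constant, neither is [p + 1], and at a root of [p + 1] the value of [p] is -1.
    Through this, algebraic closedness stands in for infinitude of [K]. *)
Lemma exists_nonroot (p : {poly K}) : p != 0 -> exists c, p.[c] != 0.
Proof.
move=> p0; have [|sp] := leqP (size p) 1.
  by move/size1_polyC=> pE; exists 0; move: p0; rewrite {1}pE polyC_eq0 horner_coef0.
have/closed_rootP[c] : size (p + 1) != 1%N.
  by rewrite size_polyDl ?size_poly1 // neq_ltn sp orbT.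
rewrite /root hornerD hornerC addr_eq0 => /eqP pc; exists c.
by rewrite pc oppr_eq0 oner_eq0.
Qed.

Lemma poly_fun_inj (p q : {poly K}) : (forall c, p.[c] = q.[c]) -> p = q.
Proof.
move=> pq; apply/eqP; rewrite -subr_eq0; apply/negPn/negP => /exists_nonroot[c].
by rewrite !hornerE pq subrr eqxx.
Qed.

Definition mono (b : triple) (x : 'rV[K]_3) : K :=
  x 0 0 ^+ b.1.1 * x 0 (inord 1) ^+ b.1.2 * x 0 (inord 2) ^+ b.2.

Definition ev t (v : 'rV[K]_(size (mons t))) (x : 'rV[K]_3) : K :=
  \sum_k v 0 k * mono (nth mon0 (mons t) k) x.

Lemma ev0 t x : ev (0 : 'rV_(size (mons t))) x = 0.
Proof. by rewrite /ev big1 // => k _; rewrite mxE mul0r. Qed.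

Lemma evD t (v w : 'rV_(size (mons t))) x : ev (v + w) x = ev v x + ev w x.
Proof. by rewrite /ev -big_split; apply: eq_bigr => k _; rewrite mxE mulrDl. Qed.

Lemma evZ t a (v : 'rV_(size (mons t))) x : ev (a *: v) x = a * ev v x.
Proof. by rewrite /ev mulr_sumr; apply: eq_bigr => k _; rewrite mxE mulrA. Qed.

Lemma ev_row t (f : triple -> K) x :
  ev (\row_(k < size (mons t)) f (nth mon0 (mons t) k)) x
  = \sum_(b <- mons t) f b * mono b x.
Proof. by rewrite (big_nth mon0) big_mkord; apply: eq_bigr => k _; rewrite mxE. Qed.

(** Coefficients addressed by exponent triple instead of position in [mons t]; a triple of the wrong
    degree gets the empty sum 0. *)
Definition coefm t (v : 'rV[K]_(size (mons t))) (b : triple) : K :=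
  \sum_(k : 'I_(size (mons t)) | nth mon0 (mons t) k == b) v 0 k.

Lemma coefm_nth t (v : 'rV_(size (mons t))) (k : 'I_(size (mons t))) :
  coefm v (nth mon0 (mons t) k) = v 0 k.
Proof.
rewrite /coefm (big_pred1 k) // => i /=.
by rewrite nth_uniq ?uniq_mons // (inj_eq val_inj).
Qed.

Lemma ev_coefm t (v : 'rV_(size (mons t))) x :
  ev v x = \sum_(b <- mons t) coefm v b * mono b x.
Proof.
rewrite (big_nth mon0) big_mkord; apply: eq_bigr => k _.
by rewrite coefm_nth.
Qed.

Definition vec3 (a b c : K) : 'rV[K]_3 := \row_i [:: a; b; c]`_i.

Lemma vec30 a b c : vec3 a b c 0 0 = a. Proof. by rewrite mxE. Qed.
Lemma vec31 a b c : vec3 a b c 0 (inord 1) = b.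
Proof. by rewrite mxE inordK. Qed.
Lemma vec32 a b c : vec3 a b c 0 (inord 2) = c.
Proof. by rewrite mxE inordK. Qed.
Definition vec3E := (vec30, vec31, vec32).

Lemma ord3P (P : 'I_3 -> Prop) : P 0 -> P (inord 1) -> P (inord 2) -> forall i, P i.
Proof.
move=> P0 P1 P2 [[|[|[|//]]] hi].
- by rewrite (_ : Ordinal hi = 0) //; apply: val_inj.
- by rewrite (_ : Ordinal hi = inord 1) //; apply: val_inj; rewrite /= inordK.
- by rewrite (_ : Ordinal hi = inord 2) //; apply: val_inj; rewrite /= inordK.
Qed.

Lemma vec3_eta x : x = vec3 (x 0 0) (x 0 (inord 1)) (x 0 (inord 2)).
Proof. by apply/rowP; elim/ord3P; rewrite vec3E. Qed.

(** Setting the last coordinate to 1 loses no coefficient of a form of known degree; [poly_fun_inj]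
    is then applied to the other two variables in turn. *)
Lemma ev_inj t (v : 'rV_(size (mons t))) : (forall x, ev v x = 0) -> v = 0.
Proof.
move=> v0; apply/rowP => k; rewrite mxE -coefm_nth.
have: nth mon0 (mons t) k \in mons t by rewrite mem_nth.
move: (nth _ _ _) => [[i j] l]; rewrite mem_mons /= => /eqP ijl.
pose q (i : nat) := \poly_(j < (t - i).+1) coefm v (i, j, t - i - j)%N.
have qE a b : ev v (vec3 a b 1) = (\poly_(i < t.+1) (q i).[b]).[a].
  rewrite ev_coefm big_mons horner_poly; apply: eq_bigr => i' _.
  rewrite /q horner_poly mulr_suml; apply: eq_bigr => j' _.
  by rewrite /mono !vec3E expr1n /=; ring.
have qi : q i = 0.
  apply: poly_fun_inj => b; rewrite horner0.
  have /(congr1 (fun p : {poly K} => p`_i)) : \poly_(i < t.+1) (q i).[b] = 0.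
    by apply: poly_fun_inj => a; rewrite -qE v0 horner0.
  by rewrite coef_poly coef0 ifT //; lia.
move/(congr1 (fun p : {poly K} => p`_j)): qi; rewrite coef_poly coef0 ifT; last lia.
by move=> <-; congr coefm; congr (_, _, _); lia.
Qed.

Definition lin (L x : 'rV[K]_3) : K := (L *m x^T) 0 0.

Lemma linE L x : lin L x = \sum_i L 0 i * x 0 i.
Proof. by rewrite /lin mxE; apply: eq_bigr => i _; rewrite mxE. Qed.

Lemma linD L x y : lin L (x + y) = lin L x + lin L y.
Proof. by rewrite /lin linearD mulmxDr mxE. Qed.

Lemma linZ L c x : lin L (c *: x) = c * lin L x.
Proof. by rewrite /lin linearZ -scalemxAr mxE. Qed.

Lemma monoZ b c x : mono b (c *: x) = c ^+ (b.1.1 + b.1.2 + b.2) * mono b x.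
Proof. by rewrite /mono !mxE !exprMn !exprD; ring. Qed.

Lemma evZr t (v : 'rV_(size (mons t))) c x : ev v (c *: x) = c ^+ t * ev v x.
Proof.
rewrite /ev mulr_sumr; apply: eq_bigr => k _; rewrite monoZ.
by have: nth mon0 (mons t) k \in mons t; [rewrite mem_nth | rewrite mem_mons => /eqP->; ring].
Qed.

(** * Linear operators on forms: products with lines and changes of coordinates *)

Definition is_form t (f : 'rV[K]_3 -> K) := exists v : 'rV_(size (mons t)), ev v =1 f.

Lemma is_form_ext t f g : f =1 g -> is_form t f -> is_form t g.
Proof. by move=> fg [v vf]; exists v => x; rewrite vf fg. Qed.

Lemma is_form_sum t (I : Type) (r : seq I) (F : I -> 'rV[K]_3 -> K) :
  (forall i, is_form t (F i)) -> is_form t (fun x => \sum_(i <- r) F i x).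
Proof.
move=> FF; elim: r => [|i r [w wE]].
  by exists 0 => x; rewrite ev0 big_nil.
by have [v vE] := FF i; exists (v + w) => x; rewrite evD big_cons vE wE.
Qed.

Lemma is_form_scale t c f : is_form t f -> is_form t (fun x => c * f x).
Proof. by move=> [v vE]; exists (c *: v) => x; rewrite evZ vE. Qed.

Lemma is_form_mono t b : b \in mons t -> is_form t (mono b).
Proof.
move=> bt; exists (\row_(k < size (mons t)) (nth mon0 (mons t) k == b)%:R) => x.
rewrite (ev_row t (fun d => (d == b)%:R)) (bigD1_seq b) ?uniq_mons //= eqxx mul1r big1 ?addr0 //.
by move=> d /negbTE->; rewrite mul0r.
Qed.

Lemma is_form_lin_mul t L f : is_form t f -> is_form t.+1 (fun x => lin L x * f x).
Proof.
move=> [v vE].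
apply: (is_form_ext (f := fun x => \sum_i \sum_(k < size (mons t))
   (L 0 i * v 0 k) * (x 0 i * mono (nth mon0 (mons t) k) x))).
  move=> x; rewrite linE mulr_suml; apply: eq_bigr => i _.
  by rewrite -vE /ev mulr_sumr; apply: eq_bigr => k _; ring.
apply: is_form_sum => i; apply: is_form_sum => k; apply: is_form_scale.
have: nth mon0 (mons t) k \in mons t by rewrite mem_nth.
move: (nth _ _ _) => [[a b] c]; rewrite mem_mons /= => /eqP abc.
elim/ord3P: i.
- apply: (is_form_ext (f := mono (a.+1, b, c))).
    by move=> x; rewrite /mono /= exprS; ring.
  by apply: is_form_mono; rewrite mem_mons /=; lia.
- apply: (is_form_ext (f := mono (a, b.+1, c))).
    by move=> x; rewrite /mono /= exprS; ring.
  by apply: is_form_mono; rewrite mem_mons /=; lia.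
- apply: (is_form_ext (f := mono (a, b, c.+1))).
    by move=> x; rewrite /mono /= exprS; ring.
  by apply: is_form_mono; rewrite mem_mons /=; lia.
Qed.

Lemma is_form_linX_mul t L e f :
  is_form t f -> is_form (e + t) (fun x => lin L x ^+ e * f x).
Proof.
move=> ff; elim: e => [|e IH].
  by apply: is_form_ext ff => x; rewrite mul1r.
by apply: is_form_ext (is_form_lin_mul L IH) => x; rewrite exprS mulrA.
Qed.

Lemma coord_lin (M : 'M[K]_3) x i : (x *m M) 0 i = lin (col i M)^T x.
Proof. by rewrite mxE linE; apply: eq_bigr => j _; rewrite !mxE mulrC. Qed.

Lemma is_form_mono_comp t b (M : 'M[K]_3) :
  b \in mons t -> is_form t (fun x => mono b (x *m M)).
Proof.
rewrite mem_mons => /eqP bt.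
have f1 : is_form 0 (fun=> 1).
  by apply: is_form_ext (is_form_mono (b := mon0) _) => // x; rewrite /mono !expr0 !mulr1.
have := is_form_linX_mul (col 0 M)^T b.1.1 (is_form_linX_mul (col (inord 1) M)^T b.1.2
         (is_form_linX_mul (col (inord 2) M)^T b.2 f1)).
rewrite addn0 addnA bt; apply: is_form_ext => x.
by rewrite /mono !coord_lin; ring.
Qed.

(** The rows of [P] are coefficient vectors of the images of the monomials. Having the operator as a
    matrix makes rank arguments available. *)
Lemma form_operator t t' (g : 'rV[K]_3 -> K) (h : 'rV[K]_3 -> 'rV[K]_3) :
  (forall b, b \in mons t -> is_form t' (fun x => g x * mono b (h x))) ->
  exists P : 'M[K]_(size (mons t), size (mons t')),
    forall v x, ev (v *m P) x = g x * ev v (h x).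
Proof.
move=> gh.
have /fin_all_exists[w wE] (k : 'I_(size (mons t))) :
    exists w : 'rV_(size (mons t')), ev w =1 fun x => g x * mono (nth mon0 (mons t) k) (h x).
  by apply: gh; rewrite mem_nth.
exists (\matrix_k w k) => v x.
have -> : v *m (\matrix_k w k) = \sum_k v 0 k *: w k.
  by rewrite mulmx_sum_row; apply: eq_bigr => k _; rewrite rowK.
rewrite (big_morph (fun w => ev w x) (fun v w => evD v w x) (ev0 t' x)).
by rewrite [in RHS]/ev mulr_sumr; apply: eq_bigr => k _; rewrite evZ wE; ring.
Qed.

Lemma lin_operator t L :
  exists P : 'M[K]_(size (mons t), size (mons t.+1)),
    forall v x, ev (v *m P) x = lin L x * ev v x.
Proof.
apply: (form_operator (h := id)) => b bt.
by apply: is_form_lin_mul; apply: is_form_mono.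
Qed.

Lemma comp_operator t (M : 'M[K]_3) :
  exists P : 'M[K]_(size (mons t)), forall v x, ev (v *m P) x = ev v (x *m M).
Proof.
have [b bt|P PE] := @form_operator t t (fun=> 1) (mulmxr M).
  by apply: is_form_ext (is_form_mono_comp M bt) => x; rewrite mul1r.
by exists P => v x; rewrite PE mul1r.
Qed.

(** * Taylor expansion and order of vanishing at a point *)

(** The binomial theorem in each coordinate, with the terms then grouped by total degree in [y]. *)
Lemma mono_taylor (b : triple) t p y c : b \in mons t ->
  mono b (p + c *: y) =
  \sum_(j < t.+1) c ^+ j * \sum_(al <- mons j) hasse_coef b al p * mono al y.
Proof.
rewrite mem_mons => /eqP bt.
pose G al := hasse_coef b al p * mono al (c *: y).
transitivity (\sum_(al <- alphas t.+1) G al); last first.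
  rewrite big_alphas; apply: eq_bigr => j _; rewrite mulr_sumr; apply: eq_big_seq => al.
  by rewrite mem_mons => /eqP aj; rewrite /G monoZ aj; ring.
(* The three binomial expansions run over the exponents below [b] coordinatewise. All have degree at
   most [t], and outside this box a binomial in [hasse_coef] is 0. *)
pose box := [seq (ij, k) | ij <- [seq (i, j) | i <- index_iota 0 b.1.1.+1,
   j <- index_iota 0 b.1.2.+1], k <- index_iota 0 b.2.+1].
have boxP al : (al \in box) = [&& al.1.1 <= b.1.1, al.1.2 <= b.1.2 & al.2 <= b.2]%N.
  case: al => [[i j] k] /=; apply/allpairsP/idP => [[[ij k'] [/allpairsP[[i' j'] []]]]|].
    by rewrite !mem_index_iota /= => hi hj -> hk [-> -> ->]; lia.
  move=> ijk; apply/allpairsP; apply: allpairs_f; last by rewrite mem_index_iota; lia.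
  by apply: allpairs_f; rewrite mem_index_iota; lia.
have boxu : uniq box.
  apply: allpairs_uniq; rewrite ?iota_uniq //; last by case=> ? ? [].
  by apply: allpairs_uniq; rewrite ?iota_uniq //; case=> ? ? [].
transitivity (\sum_(al <- box) G al).
  rewrite big_allpairs big_allpairs /mono !mxE !exprDn !big_mkord !mulr_suml.
  apply: eq_bigr => i _; rewrite big_mkord [X in X * _]mulr_sumr mulr_suml.
  apply: eq_bigr => j _; rewrite mulr_sumr big_mkord; apply: eq_bigr => k _.
  have E a1 a2 a3 b1 b2 b3 c1 c2 c3 : (a1 * b1 * c1) * (a2 * b2 * c2) * (a3 * b3 * c3)
      = (c1 * c2 * c3 * a1 * a2 * a3) * (b1 * b2 * b3) :> K by ring.
  by rewrite /G /hasse_coef /mono !mxE !natrM -![(_ * _) *+ _]mulr_natr E.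
rewrite [RHS](bigID (fun al => al \in box)) /= [X in _ + X]big1 ?addr0; last first.
  move=> al; rewrite boxP => alb; rewrite /G /hasse_coef (_ : (_ * _ * _)%N = 0)%N ?mul0r //.
  apply/eqP; rewrite !muln_eq0; move: alb; rewrite !negb_and -!ltnNge => /or3P[] h;
    by rewrite (bin_small h) eqxx ?orbT.
rewrite -[RHS]big_filter; apply/perm_big/uniq_perm; rewrite ?filter_uniq ?uniq_alphas //.
move=> [[i j] k]; rewrite mem_filter mem_alphas !boxP /=; lia.
Qed.

(** The part of degree [j] in [y] of the form evaluated at [p + y], kept as a form in [y]; no
    factorials are divided by, so the characteristic is arbitrary. *)
Definition hasse t (v : 'rV[K]_(size (mons t))) p j : 'rV[K]_(size (mons j)) :=
  \row_l \sum_k v 0 k * hasse_coef (nth mon0 (mons t) k) (nth mon0 (mons j) l) p.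

Lemma ev_hasse t (v : 'rV_(size (mons t))) p j y :
  ev (hasse v p j) y = \sum_k v 0 k *
    \sum_(al <- mons j) hasse_coef (nth mon0 (mons t) k) al p * mono al y.
Proof.
rewrite (ev_row j (fun al => \sum_k v 0 k * hasse_coef (nth mon0 (mons t) k) al p)).
under [RHS]eq_bigr do rewrite mulr_sumr.
rewrite exchange_big /=; apply: eq_bigr => al _; rewrite mulr_suml.
by apply: eq_bigr => k _; rewrite -mulrA.
Qed.

Lemma hasse_gt t (v : 'rV_(size (mons t))) p j : (t < j)%N -> hasse v p j = 0.
Proof.
move=> tj; apply/rowP => l; rewrite !mxE big1 // => k _.
have: nth mon0 (mons t) k \in mons t by rewrite mem_nth.
have: nth mon0 (mons j) l \in mons j by rewrite mem_nth.
move: (nth _ _ k) (nth _ _ l) => [[b0 b1] b2] [[a0 a1] a2].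
rewrite !mem_mons /hasse_coef /= => /eqP aj /eqP bt.
rewrite (_ : (_ * _ * _)%N = 0)%N ?mul0r ?mulr0 //.
have [h|h1] := ltnP b0 a0; first by rewrite bin_small.
have [h|h2] := ltnP b1 a1; first by rewrite (bin_small h) muln0.
by rewrite [X in (_ * X)%N]bin_small ?muln0 //; lia.
Qed.

Definition taylor t (v : 'rV[K]_(size (mons t))) p y : {poly K} :=
  \poly_(j < t.+1) ev (hasse v p j) y.

Lemma coef_taylor t (v : 'rV_(size (mons t))) p y j :
  (taylor v p y)`_j = ev (hasse v p j) y.
Proof. by rewrite coef_poly; case: ltnP => // tj; rewrite hasse_gt // ev0. Qed.

Lemma horner_taylor t (v : 'rV_(size (mons t))) p y c :
  (taylor v p y).[c] = ev v (p + c *: y).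
Proof.
rewrite horner_poly /ev; under eq_bigr do rewrite -/(ev _ _) ev_hasse mulr_suml.
rewrite exchange_big /=; apply: eq_bigr => k _.
rewrite (@mono_taylor _ t) ?mem_nth // mulr_sumr.
by apply: eq_bigr => j _; ring.
Qed.

Definition vanishes t (v : 'rV[K]_(size (mons t))) p m :=
  forall j, (j < m)%N -> hasse v p j = 0.

(** By [ev_inj], the Taylor parts of degree below [m] vanish as soon as they do in every direction
    [y], that is, when the polynomial in [c] is divisible by ['X^m]. This test needs no coordinates,
    so it survives changes of frame. *)
Lemma vanishesP t (v : 'rV_(size (mons t))) p m :
  vanishes v p m <-> forall y, exists q, forall c, ev v (p + c *: y) = c ^+ m * q.[c].
Proof.
split=> [v0 y|vq j jm].
  exists (\poly_(j < t.+1) (taylor v p y)`_(m + j)) => c.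
  rewrite -horner_taylor.
  suff {1}-> : taylor v p y = 'X^m * \poly_(j < t.+1) (taylor v p y)`_(m + j).
    by rewrite hornerM hornerXn.
  apply/polyP => i; rewrite coefXnM coef_poly; case: ltnP => im.
    by rewrite coef_taylor v0 // ev0.
  rewrite subnKC //; case: ltnP => // ti.
  by rewrite coef_taylor hasse_gt ?ev0 //; lia.
apply: ev_inj => y; have [q qE] := vq y; rewrite -coef_taylor.
have -> : taylor v p y = 'X^m * q.
  by apply: poly_fun_inj => c; rewrite horner_taylor qE hornerM hornerXn.
by rewrite coefXnM jm.
Qed.

(** * Multiplication by the equation of a line, and residuals *)

Lemma lin_neq0 L : L != 0 -> exists x, lin L x = 1.
Proof.
move=> L0; have [i Li] : exists i, L 0 i != 0.
  apply/existsP; apply: contraR L0; rewrite negb_exists => /forallP L0.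
  by apply/eqP/rowP => i; have := L0 i; rewrite negbK mxE => /eqP.
exists ((L 0 i)^-1 *: delta_mx 0 i); rewrite linZ /lin mxE (bigD1 i) //= big1.
  by rewrite !mxE !eqxx mulr1 addr0 mulVf.
by move=> j /negbTE ji; rewrite !mxE eqxx ji mulr0.
Qed.

(** In a direction [e] with [lin L e = 1], the line becomes a monic polynomial of degree one, and
    [{poly K}] has no zero divisors. *)
Lemma lin_mul_inj t L (v : 'rV_(size (mons t))) : L != 0 ->
  (forall x, lin L x * ev v x = 0) -> v = 0.
Proof.
move=> /lin_neq0[e Le] Lv; apply: ev_inj => x.
have : ((lin L x)%:P + 'X) * taylor v x e = 0.
  apply: poly_fun_inj => c; rewrite !hornerE horner_taylor.
  by have := Lv (x + c *: e); rewrite linD linZ Le mulr1.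
move/eqP; rewrite mulf_eq0 addrC -[lin L x]opprK polyCN polyXsubC_eq0 /= => /eqP v0.
by rewrite -[x]addr0 -(scale0r e) -horner_taylor v0 horner0.
Qed.

Section LinMul.

Variables (t : nat) (L : 'rV[K]_3).
Variables (f : 'rV[K]_(size (mons t.+1))) (g : 'rV[K]_(size (mons t))).
Hypotheses (L0 : L != 0) (fg : forall x, ev f x = lin L x * ev g x).

Lemma taylor_lin_mul p y :
  taylor f p y = ((lin L p)%:P + 'X * (lin L y)%:P) * taylor g p y.
Proof.
apply: poly_fun_inj => c; rewrite !hornerE !horner_taylor fg linD linZ.
by [].
Qed.

(** Comparing Taylor parts, part [j + 1] of [f] is [lin L p] times part [j + 1] of [g] plus [lin L]
    times part [j] of [g]. On the line only the second term is left and the order shifts by one; off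
    the line [lin L p] is invertible and an induction on [j] clears the parts of [g]. *)
Lemma vanishes_lin_mul p m :
  vanishes f p m <-> vanishes g p (if lin L p == 0 then m.-1 else m).
Proof.
have E0 y : ev (hasse f p 0) y = lin L p * ev (hasse g p 0) y.
  rewrite -coef_taylor taylor_lin_mul mulrDl coefD coefCM coef_taylor.
  by rewrite -mulrA coefXM addr0.
have ES j y : ev (hasse f p j.+1) y =
    lin L p * ev (hasse g p j.+1) y + lin L y * ev (hasse g p j) y.
  rewrite -coef_taylor taylor_lin_mul mulrDl coefD coefCM coef_taylor.
  by rewrite -mulrA coefXM /= coefCM coef_taylor.
case: eqP => [Lp|/eqP Lp]; split=> v0.
- move=> j jm; apply: (lin_mul_inj L0) => y.
  by have := ES j y; rewrite Lp mul0r add0r v0 ?ev0 //; lia.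
- case=> [|j] jm; apply: ev_inj => y; first by rewrite E0 Lp mul0r.
  by rewrite ES Lp mul0r add0r v0 ?ev0 ?mulr0 //; lia.
- elim=> [|j IH] jm; apply: ev_inj => y.
    by apply: (mulfI Lp); rewrite -E0 v0 // ev0 mulr0.
  apply: (mulfI Lp); have := ES j y.
  by rewrite v0 // IH ?ev0 ?mulr0 ?addr0 //; lia.
- case=> [|j] jm; apply: ev_inj => y; first by rewrite E0 v0 // ev0 mulr0.
  by rewrite ES !v0 ?ev0 ?mulr0 ?addr0 //; lia.
Qed.

End LinMul.

Definition in_ideal t (v : 'rV[K]_(size (mons t))) (A : seq ('rV[K]_3 * nat)) :=
  forall pm, pm \in A -> vanishes v pm.1 pm.2.

Lemma sub_ker_condmx A t (v : 'rV_(size (mons t))) :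
  reflect (in_ideal v A) (v <= kermx (condmx A t))%MS.
Proof.
apply: (iffP sub_kermxP) => [vA pm pmA j jm|vA].
  apply/rowP => l; rewrite !mxE.
  have cA : (pm.1, nth mon0 (mons j) l) \in conds A.
    apply/flatten_mapP; exists pm => //; apply: map_f; rewrite mem_alphas.
    have: nth mon0 (mons j) l \in mons j by rewrite mem_nth.
    by rewrite mem_mons => /eqP->.
  move/matrixP/(_ 0 (Ordinal (etrans (index_mem _ _) cA))): vA; rewrite !mxE => E.
  rewrite -[RHS]E; apply: eq_bigr => k _.
  by rewrite mxE /= nth_index.
apply/rowP => c; rewrite !mxE.
have : nth (0, mon0) (conds A) c \in conds A by rewrite mem_nth.
move=> /flatten_mapP[pm pmA /mapP[al]]; rewrite mem_alphas => alm cE.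
have alj : al \in mons (al.1.1 + al.1.2 + al.2) by rewrite mem_mons.
have /rowP/(_ (Ordinal (etrans (index_mem _ _) alj))) := vA _ pmA _ alm.
rewrite !mxE => E; rewrite -[RHS]E; apply: eq_bigr => k _.
by rewrite mxE cE /= nth_index.
Qed.

Lemma in_ideal_lin_mul t L (f : 'rV_(size (mons t.+1))) (g : 'rV_(size (mons t))) A :
  L != 0 -> (forall x, ev f x = lin L x * ev g x) ->
  in_ideal f A <-> in_ideal g (residual A L).
Proof.
move=> L0 fg; split=> [fA pm /mapP[pm' pm'A ->]|gA pm pmA].
  by apply/(vanishes_lin_mul L0 fg)/fA.
apply/(vanishes_lin_mul L0 fg).
by have := gA _ (map_f _ pmA).
Qed.

Lemma dimI_residual_le A L t : L != 0 -> (dimI (residual A L) t <= dimI A t.+1)%N.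
Proof.
move=> L0; have [P PE] := lin_operator t L.
have Pfree : row_free P.
  by apply: inj_row_free => v vP; apply: (lin_mul_inj L0) => x; rewrite -PE vP ev0.
rewrite /dimI -(mxrankMfree _ Pfree); apply/mxrankS/row_subP => i.
rewrite row_mul; apply/sub_ker_condmx/(in_ideal_lin_mul _ L0); first exact: PE.
by apply/sub_ker_condmx/row_sub.
Qed.

(** * Counting conditions: the lower bound for [dimI] *)

Lemma ord3_neq : ((inord 1 == 0 :> 'I_3) = false) * ((inord 2 == 0 :> 'I_3) = false)
  * ((0 == inord 2 :> 'I_3) = false) * ((inord 1 == inord 2 :> 'I_3) = false).
Proof. by do !split; rewrite -val_eqE /= !inordK. Qed.

(** Gaussian elimination of a single row: [col_ebase x] is a nonzero scalar, and by it the first row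
    of [row_ebase x] is a multiple of [x]. *)
Lemma basis_completion x : x != 0 -> exists2 M : 'M[K]_3, M \in unitmx & row 0 M = x.
Proof.
move=> x0; have rx : \rank x = 1%N by rewrite rank_rV x0.
pose a := col_ebase x 0 0; exists (a *: row_ebase x).
  rewrite unitmxZ ?row_ebase_unit //.
  by have := col_ebase_unit x; rewrite {1}[col_ebase x]mx11_scalar unitmxE det_scalar expr1.
rewrite -[RHS](mulmx_ebase x) rx [X in X *m pid_mx _]mx11_scalar mul_scalar_mx -scalemxAl.
rewrite linearZ /=; congr (_ *: _); apply/rowP => i; rewrite !mxE (bigD1 0) //= big1.
  by rewrite !mxE /= mul1r addr0.
by move=> j j0; rewrite !mxE eq_sym (negbTE (j0 : j != 0 :> nat)) mul0r.
Qed.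

Lemma ev_zero_coords t (F : 'rV[K]_(size (mons t))) a b :
  ev F (vec3 0 a b) = \sum_(j < t.+1) coefm F (0, j : nat, t - j)%N * a ^+ j * b ^+ (t - j).
Proof.
rewrite ev_coefm big_mons big_ord_recl [X in _ + X]big1 ?addr0.
  rewrite /= subn0; apply: eq_bigr => j _.
  by rewrite /mono !vec3E expr0 mul1r mulrA.
by move=> i _; apply: big1 => j _; rewrite /mono !vec3E /= expr0n /= !mul0r mulr0.
Qed.

Definition selmx t n (s : 'I_n -> triple) : 'M[K]_(size (mons t), n) :=
  \matrix_(k, c) (nth mon0 (mons t) k == s c)%:R.

Lemma mul_selmx t n (s : 'I_n -> triple) (v : 'rV[K]_(size (mons t))) (c : 'I_n) :
  (v *m selmx t s) 0 c = coefm v (s c).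
Proof.
rewrite mxE /coefm [RHS]big_mkcond; apply: eq_bigr => k _.
by rewrite mxE; case: eqP; rewrite ?mulr1 ?mulr0.
Qed.

(** Adjusting the first exponent so that the total degree is [m - 1] injects these monomials into
    those of degree [m - 1]. *)
Lemma size_low_mons t m :
  (size [seq b <- mons t | (b.1.2 + b.2 < m)%N] <= 'C(m.+1, 2))%N.
Proof.
case: m => [|m]; first by rewrite (@eq_filter _ _ pred0) ?filter_pred0 // => b; rewrite ltn0.
rewrite -size_mons.
pose h (b : triple) := (m - b.1.2 - b.2, b.1.2, b.2)%N.
rewrite -(size_map h); apply: uniq_leq_size.
  rewrite map_inj_in_uniq ?filter_uniq ?uniq_mons // => -[[i j] k] [[i' j'] k'].
  rewrite !mem_filter !mem_mons /= => /andP[_ /eqP h1] /andP[_ /eqP h2] [_ h3 h4].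
  by congr (_, _, _) => //; lia.
move=> b /mapP[[[i j] k]]; rewrite mem_filter mem_mons /= => /andP[h1 _] ->.
by rewrite mem_mons /=; lia.
Qed.

(** The point [p] contributes ['C(m.+2, 3)] columns to [condmx], too many for the bound. After
    moving [p] to [(1, 0, 0)], it is enough to kill the coefficients of the monomials of degree
    below [m] in the last two variables. *)
Lemma fat_point_conditions t p m : p != 0 ->
  exists N, exists B : 'M[K]_(size (mons t), N),
    (N <= 'C(m.+1, 2))%N /\ forall v, v *m B = 0 -> vanishes v p m.
Proof.
move=> /basis_completion[M Mu Mp]; have [P PE] := comp_operator t M.
pose s := [seq b <- mons t | (b.1.2 + b.2 < m)%N].
exists (size s), (P *m selmx t (fun c : 'I_(size s) => nth mon0 s c)).
split=> [|v]; first exact: size_low_mons.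
rewrite mulmxA; set F := v *m P => F0.
have {}F0 b : b \in mons t -> (b.1.2 + b.2 < m)%N -> coefm F b = 0.
  move=> bt bm; have bs : b \in s by rewrite mem_filter bm bt.
  move/rowP/(_ (Ordinal (etrans (index_mem _ _) bs))): F0.
  by rewrite mul_selmx mxE /= nth_index.
apply/vanishesP => y; pose z := y *m invmx M.
(* In the new frame the point is [(1 + c z0, c z1, c z2)], so a monomial carries [c] to the power
   [b.1.2 + b.2], from which [m] factors are removed. Where the subtraction truncates, the
   coefficient is 0. *)
exists (\sum_(b <- mons t) (coefm F b * z 0 (inord 1) ^+ b.1.2 * z 0 (inord 2) ^+ b.2)%:P
   * (1 + (z 0 0)%:P * 'X) ^+ b.1.1 * 'X^(b.1.2 + b.2 - m)) => c.
have -> : p + c *: y = (vec3 1 0 0 + c *: z) *m M.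
  rewrite mulmxDl -scalemxAl mulmxKV //; congr (_ + _); rewrite -Mp rowE; congr (_ *m _).
  by apply/rowP; elim/ord3P; rewrite vec3E !mxE ?ord3_neq.
have -> : vec3 1 0 0 + c *: z = vec3 (1 + c * z 0 0) (c * z 0 (inord 1)) (c * z 0 (inord 2)).
  by apply/rowP; elim/ord3P; rewrite [RHS]vec3E mxE vec3E ?add0r mxE.
rewrite -PE -/F ev_coefm horner_sum mulr_sumr; apply: eq_big_seq => b bt.
have [bm|bm] := ltnP (b.1.2 + b.2) m; first by rewrite !hornerM hornerC F0 ?mul0r ?mulr0.
rewrite !hornerM hornerXn hornerC horner_exp !hornerE /mono !vec3E !exprMn.
have E : c ^+ m * c ^+ (b.1.2 + b.2 - m) = c ^+ b.1.2 * c ^+ b.2.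
  by rewrite -!exprD subnKC.
rewrite /= [c * z 0 0]mulrC.
transitivity (coefm F b * (1 + z 0 0 * c) ^+ b.1.1 * z 0 (inord 1) ^+ b.1.2
   * z 0 (inord 2) ^+ b.2 * (c ^+ b.1.2 * c ^+ b.2)); first by ring.
by rewrite -E; move: (c ^+ m) (c ^+ _) => c1 c2; ring.
Qed.

Lemma fat_points_conditions t (A : seq ('rV[K]_3 * nat)) :
  (forall pm, pm \in A -> pm.1 != 0) ->
  exists N, exists B : 'M[K]_(size (mons t), N),
    (N <= \sum_(pm <- A) 'C(pm.2.+1, 2))%N /\ forall v, v *m B = 0 -> in_ideal v A.
Proof.
elim: A => [|pm A IH] A0.
  by exists 0%N, 0; split=> // v _ pm; rewrite in_nil.
have [|N [B [NB BP]]] := IH; first by move=> q qA; apply: A0; rewrite inE qA orbT.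
have [|N' [B' [NB' BP']]] := @fat_point_conditions t pm.1 pm.2.
  by apply: A0; rewrite inE eqxx.
exists (N' + N)%N, (row_mx B' B); split; first by rewrite big_cons leq_add.
move=> v; rewrite mul_mx_row => /eqP; rewrite row_mx_eq0 => /andP[/eqP v1 /eqP v2] q.
by rewrite inE => /predU1P[->|]; [apply: BP' | apply: BP].
Qed.

Lemma dimI_ge (A : seq ('rV[K]_3 * nat)) t : (forall pm, pm \in A -> pm.1 != 0) ->
  ('C(t.+2, 2) <= dimI A t + \sum_(pm <- A) 'C(pm.2.+1, 2))%N.
Proof.
move=> /(fat_points_conditions t)[N [B [NB BP]]].
have : (\rank (kermx B) <= dimI A t)%N.
  apply/mxrankS/row_subP => i; apply/sub_ker_condmx/BP.
  by apply/sub_kermxP/row_sub.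
by rewrite mxrank_ker; have := rank_leq_col B; have := size_mons t; lia.
Qed.

(** * Restriction to a line: the upper bound for [dimI] *)

(** A basis starting with [L] makes the line [y0 = 0]. A shear adding [c] times the middle
    coordinate to the last one, for generic [c], then moves finitely many points of the line away
    from last coordinate 0. *)
Lemma line_frame L (ps : seq 'rV[K]_3) : L != 0 ->
  exists M N : 'M[K]_3, [/\ N *m M = 1%:M, forall y, lin L (y *m M) = y 0 0
    & forall p, p \in ps -> p != 0 -> lin L p = 0 -> (p *m N) 0 (inord 2) != 0].
Proof.
move=> /basis_completion[U Uu UL].
have LU y : lin L (y *m (invmx U)^T) = y 0 0.
  rewrite /lin trmx_mul trmxK mulmxA -UL -row_mul mulmxV // row1 -rowE.
  by rewrite !mxE.
pose y p := p *m U^T.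
(* Each factor is the last coordinate of a sheared point as a polynomial in the shear parameter. It
   is nonzero, since otherwise all coordinates of the nonzero point would vanish. *)
pose Q := \prod_(p <- ps | (p != 0) && (lin L p == 0))
  ((y p 0 (inord 2))%:P + (y p 0 (inord 1))%:P * 'X).
have yU p : y p *m (invmx U)^T = p.
  by rewrite -mulmxA -trmx_mul mulVmx // trmx1 mulmx1.
have Q0 : Q != 0.
  rewrite prodf_seq_neq0; apply/allP => p _; apply/implyP => /andP[p0 Lp].
  apply: contra p0 => /eqP q0.
  have yp i : [:: lin L p; y p 0 (inord 1); y p 0 (inord 2)]`_i = 0.
    case: i => [|[|[|i]]] /=; first exact/eqP.
    - move/(congr1 (fun q : {poly K} => q`_1)): q0.
      by rewrite coefD coefC coefMX coefC coef0 add0r.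
    - move/(congr1 (fun q : {poly K} => q`_0)): q0.
      by rewrite coefD coefC coefMX coef0 addr0.
    - by rewrite nth_nil.
  rewrite -(yU p) (_ : y p = 0) ?mul0mx //; apply/rowP.
  elim/ord3P; rewrite [RHS]mxE; [|exact: (yp 1%N) | exact: (yp 2%N)].
  by rewrite -LU yU; apply: (yp 0%N).
have [c] := exists_nonroot Q0; rewrite horner_prod prodf_seq_neq0 => /allP cP.
(* As [E] squares to 0, the shears with parameters [c] and [-c] are inverse to each other. *)
pose E : 'M[K]_3 := delta_mx (inord 1) (inord 2).
have EE : E *m E = 0 by rewrite mul_delta_mx_cond eq_sym ord3_neq.
have yE (z : 'rV[K]_3) i : (z *m E) 0 i = z 0 (inord 1) * (i == inord 2)%:R.
  rewrite mxE (bigD1 (inord 1)) //= big1 ?addr0; first by rewrite mxE eqxx.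
  by move=> j /negbTE j1; rewrite mxE j1 mulr0.
exists ((1%:M - c *: E) *m (invmx U)^T), (U^T *m (1%:M + c *: E)); split.
- have T : (1%:M + c *: E) *m (1%:M - c *: E) = 1%:M.
    rewrite mulmxBr mulmx1 mulmxDl mul1mx -scalemxAl -scalemxAr EE !scaler0 addr0.
    by rewrite addrK.
  by rewrite -mulmxA [(1%:M + _) *m _]mulmxA T mul1mx -trmx_mul mulVmx // trmx1.
- move=> z; rewrite mulmxA LU mulmxBr mulmx1 -scalemxAr mxE [X in _ + X]mxE [X in - X]mxE yE.
  by rewrite ord3_neq !mulr0 oppr0 addr0.
- move=> p pps p0 /eqP Lp; have /implyP := cP _ pps; rewrite p0 Lp => /(_ isT).
  rewrite !hornerE => yc; rewrite mulmxA -/(y p) mulmxDr mulmx1 -scalemxAr mxE.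
  by rewrite [X in _ + X]mxE yE eqxx mulr1 mulrC.
Qed.

(** In a frame where the line is [y0 = 0], vanishing on it kills every coefficient of a monomial
    without [y0], and the others are divided by [y0]. *)
Lemma vanishes_on_line_dvd t L (v : 'rV[K]_(size (mons t.+1))) : L != 0 ->
  (forall x, lin L x = 0 -> ev v x = 0) ->
  exists g : 'rV[K]_(size (mons t)), forall x, ev v x = lin L x * ev g x.
Proof.
move=> /(line_frame [::])[M [N [NM LM _]]] v0.
have [P PE] := comp_operator t.+1 M; set F := v *m P.
have F0 j : (j <= t.+1)%N -> coefm F (0, j, t.+1 - j)%N = 0.
  move=> jt; have : \poly_(j < t.+2) coefm F (0, j, t.+1 - j)%N = 0.
    apply: poly_fun_inj => a; rewrite horner0 horner_poly.
    rewrite -[RHS](v0 (vec3 0 a 1 *m M)) ?LM ?vec3E // -PE ev_zero_coords.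
    by apply: eq_bigr => i _; rewrite expr1n mulr1.
  by move/(congr1 (fun p : {poly K} => p`_j)); rewrite coef_poly coef0 ltnS jt.
have [G GE] : is_form t (fun y => \sum_(i < t.+1) \sum_(j < (t - i).+1)
    coefm F (i.+1, j : nat, t - i - j)%N * mono (i : nat, j : nat, t - i - j)%N y).
  apply: is_form_sum => i; apply: is_form_sum => j; apply: is_form_scale.
  by apply: is_form_mono; rewrite mem_mons /=; have := ltn_ord i; have := ltn_ord j; lia.
have [P' P'E] := comp_operator t N.
exists (G *m P') => x; rewrite P'E GE.
have -> : x = x *m N *m M by rewrite -mulmxA NM mulmx1.
rewrite -PE -/F LM -!mulmxA [M *m N](mulmx1C NM) mulmx1; move: (x *m N) => y.
rewrite ev_coefm big_mons big_ord_recl big1 ?add0r; last first.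
  by move=> j _; rewrite (F0 j) ?mul0r //; apply: (ltn_ord j).
rewrite mulr_sumr; apply: eq_bigr => i _; rewrite mulr_sumr /= subSS.
apply: eq_bigr => j _; rewrite /bump /mono /= add1n exprS; ring.
Qed.

(** Replaces division by [L] in degree 0: a constant equals its value at the zero vector, where
    every linear form vanishes. *)
Lemma vanishes_on_line_deg0 L (v : 'rV[K]_(size (mons 0))) :
  (forall x, lin L x = 0 -> ev v x = 0) -> v = 0.
Proof.
move=> v0; apply: ev_inj => x.
have e0 y : ev v y = ev v 0.
  by rewrite !ev_coefm; apply: eq_big_seq => b; rewrite mem_mons /mono;
     case: b => [[[|?] [|?]] [|?]].
by rewrite e0 v0 // /lin trmx0 mulmx0 mxE.
Qed.

(** The multiples of [Q] among polynomials of size at most [n] are spanned by the ['X^i * Q] with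
    [i < e]. If [Q] is too large for any nonzero multiple, truncation gives [e = 0]. *)
Lemma rank_le_dvdp m n (W : 'M[K]_(m, n)) (Q : {poly K}) : Q != 0 ->
  (forall i, Q %| rVpoly (row i W)) -> (\rank W <= n - (size Q).-1)%N.
Proof.
move=> Q0 QW; set e := (n - _)%N.
pose D : 'M[K]_(e, n) := \matrix_(i < e) poly_rV ('X^i * Q).
apply: leq_trans (rank_leq_row D); apply/mxrankS/row_subP => i.
have [h hE] : exists h : {poly K}, rVpoly (row i W) = h * Q by apply/dvdpP.
have sh : (size h <= e)%N.
  have [->|h0] := eqVneq h 0; first by rewrite size_poly0.
  have : (size (rVpoly (row i W)) <= n)%N by apply: size_poly.
  rewrite hE size_mul // /e; have := size_poly_gt0 Q; rewrite Q0.
  by move: (size h) (size Q) => a b; lia.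
rewrite -[row i W]rVpolyK hE.
suff -> : poly_rV (h * Q) = (\row_(j < e) h`_j) *m D by apply: submxMl.
have {1}-> : h = \sum_(j < e) h`_j *: 'X^j.
  rewrite -poly_def; apply/polyP => k; rewrite coef_poly.
  by case: ltnP => // ek; rewrite nth_default // (leq_trans sh).
rewrite mulmx_sum_row mulr_suml linear_sum; apply: eq_bigr => j _ /=.
by rewrite rowK mxE -scalerAl linearZ.
Qed.

Lemma prod_XsubC_exp_dvdp (s : seq (K * nat)) (g : {poly K}) : uniq (unzip1 s) ->
  (forall am, am \in s -> ('X - am.1%:P) ^+ am.2 %| g) ->
  \prod_(am <- s) ('X - am.1%:P) ^+ am.2 %| g.
Proof.
elim: s => [|[a m] s IH] /=; first by rewrite big_nil dvd1p.
move=> /andP[nas us] sg; rewrite big_cons Gauss_dvdp; last first.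
  apply: coprimep_expl; rewrite coprimep_sym coprimep_XsubC /root horner_prod.
  rewrite prodf_seq_neq0; apply/allP => -[b k] bs; apply/implyP => _.
  rewrite horner_exp !hornerE; apply: expf_neq0; rewrite subr_eq0.
  by apply: contra nas => /eqP /= ->; apply: (map_f fst bs).
rewrite (sg (a, m)) ?inE ?eqxx //= IH // => am ams.
by apply: sg; rewrite inE ams orbT.
Qed.

Lemma size_prod_XsubC_exp (s : seq (K * nat)) :
  (size (\prod_(am <- s) ('X - am.1%:P) ^+ am.2)).-1 = (\sum_(am <- s) am.2)%N.
Proof.
elim: s => [|[a m] s IH]; first by rewrite !big_nil size_poly1.
have m0 (u : seq (K * nat)) : \prod_(am <- u) ('X - am.1%:P) ^+ am.2 != 0.
  by rewrite prodf_seq_neq0; apply/allP => am _; rewrite expf_neq0 ?polyXsubC_eq0.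
rewrite !big_cons -IH /= size_proper_mul ?size_exp_XsubC; last first.
  by rewrite mulf_neq0 ?lead_coef_eq0 ?expf_neq0 ?polyXsubC_eq0 ?m0.
by have := m0 s; rewrite -size_poly_gt0; move: (size _) => k; lia.
Qed.

(** Mentions the points without multiplicities, so it passes unchanged to residuals. *)
Definition distinct_points (ps : seq 'rV[K]_3) :=
  [/\ uniq ps, forall p, p \in ps -> p != 0
    & forall p q c, p \in ps -> q \in ps -> q = c *: p -> q = p].

Lemma fat_point_scheme_distinct A : fat_point_scheme A -> distinct_points (unzip1 A).
Proof.
move=> [A0 AN]; pose d := (0, 0%N) : 'rV[K]_3 * nat.
have nthE i : (i < size A)%N -> nth 0 (unzip1 A) i = (nth d A i).1.
  by move=> iA; rewrite (nth_map d).
split.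
- apply/(uniqP 0) => i j; rewrite !inE size_map => iA jA; rewrite !nthE // => ij.
  apply/eqP/negPn/negP => nij; have := AN _ _ iA jA nij 1.
  by rewrite scale1r ij eqxx.
- move=> p /(nthP 0)[i]; rewrite size_map => iA <-; rewrite nthE //; exact: A0.
- move=> p q c /(nthP 0)[i]; rewrite size_map => iA <-.
  move=> /(nthP 0)[j]; rewrite size_map => jA <-; rewrite !nthE // => ji.
  have [->//|nij] := eqVneq i j; have := AN _ _ iA jA nij c.
  by rewrite ji eqxx.
Qed.

(* In a frame where the line is [y0 = 0] and every listed point on it has nonzero last
   coordinate, restricting to the line is evaluating at [(0, s, 1)]; a form vanishing to
   order [m] at a point then restricts to a polynomial with a root of multiplicity [m]. *)
Lemma line_restriction A L t : L != 0 -> distinct_points (unzip1 A) ->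
  exists R : 'M[K]_(size (mons t), t.+1),
    (\rank (kermx (condmx A t) *m R) <= t.+1 - mult_on A L)%N /\
    forall v, v *m R = 0 -> forall x, lin L x = 0 -> ev v x = 0.
Proof.
move=> L0 [uA A0 AN]; have [M [N [NM LM LN]]] := line_frame (unzip1 A) L0.
have [P PE] := comp_operator t M.
pose s (j : 'I_t.+1) := (0, j : nat, t - j)%N.
have MK x : x *m N *m M = x by rewrite -mulmxA NM mulmx1.
have onL x : lin L x = 0 -> x *m N = vec3 0 ((x *m N) 0 (inord 1)) ((x *m N) 0 (inord 2)).
  by move=> Lx; rewrite {1}[x *m N]vec3_eta -LM MK Lx.
exists (P *m selmx t s); split; last first.
  move=> v; rewrite mulmxA => v0 x Lx; rewrite -(MK x) -PE onL // ev_zero_coords.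
  by rewrite big1 // => j _; rewrite -(mul_selmx s) v0 mxE !mul0r.
(* The affine coordinate [s] of the point on the line; its denominator is nonzero by the choice of
   frame. *)
pose ratio p := (p *m N) 0 (inord 1) / (p *m N) 0 (inord 2).
pose B := [seq pm <- A | on_line L pm.1].
pose S := [seq (ratio pm.1, pm.2) | pm <- B].
pose Q := \prod_(am <- S) ('X - am.1%:P) ^+ am.2.
have BP pm : pm \in B -> [/\ pm \in A, pm.1 \in unzip1 A, lin L pm.1 = 0 & pm.1 != 0].
  rewrite mem_filter => /andP[/eqP Lp pA]; have pu := map_f fst pA.
  by split => //; apply: A0.
have ratioP pm : pm \in B ->
    vec3 0 (ratio pm.1) 1 *m M = ((pm.1 *m N) 0 (inord 2))^-1 *: pm.1.
  move=> /BP[pA pu Lp p0]; rewrite -[X in _ *: X](MK pm.1) scalemxAl; congr (_ *m _).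
  apply/rowP; elim/ord3P; rewrite [RHS]mxE !vec3E.
  - by rewrite -LM MK Lp mulr0.
  - by rewrite /ratio mulrC.
  - by rewrite mulVf // LN.
have -> : mult_on A L = (size Q).-1.
  by rewrite size_prod_XsubC_exp /S big_map /B big_filter.
apply: rank_le_dvdp => [|i].
  by rewrite prodf_seq_neq0; apply/allP => am _; rewrite expf_neq0 ?polyXsubC_eq0.
have /sub_ker_condmx vA := row_sub i (kermx (condmx A t)).
rewrite row_mul; move: (row i _) vA => v vA.
have rE a : (rVpoly (v *m (P *m selmx t s))).[a] = ev v (vec3 0 a 1 *m M).
  rewrite -PE ev_zero_coords (horner_coef_wide a (size_poly _ _)).
  by apply: eq_bigr => j _; rewrite coef_rVpoly_ord mulmxA mul_selmx expr1n mulr1.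
apply: prod_XsubC_exp_dvdp => [|_ /mapP[pm pB ->] /=].
  rewrite /unzip1 -map_comp (@eq_map _ _ _ (ratio \o fst)) // map_comp.
  rewrite map_inj_in_uniq; last first.
    (* Points of the line with equal affine coordinates are proportional, hence equal. *)
    move=> _ _ /mapP[pm pB ->] /mapP[pm' pB' ->] /= rr.
    have := ratioP _ pB; rewrite rr (ratioP _ pB') => E.
    have [[_ pu Lp p0] [_ pu' Lp' p0']] := (BP _ pB, BP _ pB').
    apply/esym/(AN _ _ (((pm'.1 *m N) 0 (inord 2)) * ((pm.1 *m N) 0 (inord 2))^-1)) => //.
    by rewrite -scalerA -E scalerA mulfV ?scale1r ?LN.
  by apply: subseq_uniq uA; apply/map_subseq/filter_subseq.
have [pA pu Lp p0] := BP _ pB.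
set l := (pm.1 *m N) 0 (inord 2); have l0 : l != 0 by rewrite LN.
(* With [r] the ratio of [p] and [e] the image of [(0, 1, 0)] under [M], the point with coordinate
   [a] is [l^-1] times [p + (a - r) l e]. Order [m] at [p] in the direction [l e] gives the factor
   [(a - r)^m], and homogeneity the factor [l^-t]. *)
have /vanishesP/(_ (l *: (vec3 0 1 0 *m M)))[q qE] := vA _ pA.
apply/dvdpP; exists (l^-1 ^+ t *: (q \Po ('X - (ratio pm.1)%:P))).
apply: poly_fun_inj => a; rewrite rE hornerM hornerZ horner_comp horner_exp hornerXsubC.
rewrite -mulrA [q.[_] * _]mulrC -qE -evZr; congr (ev v _).
rewrite scalerDr -ratioP // !scalerA -mulrA; rewrite mulrCA mulVf // mulr1 scalemxAl -mulmxDl.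
congr (_ *m _); apply/rowP; elim/ord3P; rewrite !mxE /= ?inordK //= ?mulr0 ?mulr1 ?addr0 //.
by rewrite addrC subrK.
Qed.

(** Rank-nullity for the restriction matrix [R]: [line_restriction] bounds the image, and the forms
    in the kernel are [L] times forms in the ideal of the residual. *)
Lemma dimI_le_residual A L t : L != 0 -> distinct_points (unzip1 A) ->
  (dimI A t.+1 <= dimI (residual A L) t + (t.+2 - mult_on A L))%N.
Proof.
move=> L0 dA; have [R [rR RP]] := line_restriction t.+1 L0 dA.
have [P PE] := lin_operator t L.
rewrite {1}/dimI -(mxrank_mul_ker _ R) addnC leq_add // /dimI.
apply: leq_trans (mxrankM_maxl _ P); apply/mxrankS/row_subP => i.
set C := (_ :&: _)%MS; move: (row_sub i C); rewrite sub_capmx; move: (row i C) => v.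
move=> /andP[/sub_ker_condmx vA /sub_kermxP/RP vR].
have [g gE] := vanishes_on_line_dvd L0 vR.
have -> : v = g *m P.
  apply/eqP; rewrite -subr_eq0 -scaleN1r; apply/eqP/ev_inj => x.
  by rewrite evD evZ PE gE mulN1r subrr.
by apply/submxMr/sub_ker_condmx/(in_ideal_lin_mul _ L0 gE).
Qed.

Lemma dimI0_le A L : L != 0 -> distinct_points (unzip1 A) ->
  (dimI A 0 <= 1 - mult_on A L)%N.
Proof.
move=> L0 dA; have [R [rR RP]] := line_restriction 0 L0 dA.
rewrite /dimI -(mxrank_mul_ker _ R); set C := (_ :&: _)%MS.
suff -> : C = 0 by rewrite mxrank0 addn0.
apply/row_matrixP => i; rewrite row0.
move: (row_sub i C); rewrite sub_capmx => /andP[_ /sub_kermxP/RP].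
exact: vanishes_on_line_deg0.
Qed.

Lemma dimI_le (A : seq ('rV[K]_3 * nat)) t : (dimI A t <= 'C(t.+2, 2))%N.
Proof. by rewrite -size_mons; apply: rank_leq_row. Qed.

(** * Iteration along the reducing lines *)

Lemma red_vec_cons (A : seq ('rV[K]_3 * nat)) L Ls :
  red_vec A (L :: Ls) = mult_on A L :: red_vec (residual A L) Ls.
Proof.
rewrite /red_vec /= -[1%N]/(1 + 0)%N iotaDl -map_comp.
by congr (_ :: _); apply: eq_map => j.
Qed.

Lemma size_red_vec (A : seq ('rV[K]_3 * nat)) Ls : size (red_vec A Ls) = size Ls.
Proof. by rewrite size_map size_iota. Qed.

Lemma unzip1_residual (A : seq ('rV[K]_3 * nat)) L : unzip1 (residual A L) = unzip1 A.
Proof. by rewrite /unzip1 -map_comp; apply: eq_map. Qed.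

(** By Pascal's rule, lowering a multiplicity [m] by one removes exactly [m] conditions. *)
Lemma sum_bin_residual (A : seq ('rV[K]_3 * nat)) L :
  (\sum_(pm <- A) 'C(pm.2.+1, 2) =
   mult_on A L + \sum_(pm <- residual A L) 'C(pm.2.+1, 2))%N.
Proof.
rewrite /mult_on big_map [X in (X + _)%N]big_mkcond -big_split; apply: eq_bigr => -[p m] _ /=.
by case: ifP => // _; case: m => //= m; rewrite binS bin1 addnC.
Qed.

Lemma sumn_red_vec (A : seq ('rV[K]_3 * nat)) Ls : totally_reduces A Ls ->
  sumn (red_vec A Ls) = (\sum_(pm <- A) 'C(pm.2.+1, 2))%N.
Proof.
elim: Ls A => [|L Ls IH] A.
  by move=> /allP A0; rewrite big_seq big1 // => pm /A0 /eqP ->.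
by move=> /IH; rewrite red_vec_cons (sum_bin_residual A L) /= => ->.
Qed.

(** Total reduction makes the entries from [i] on add up to the number of conditions of the [i]-th
    residual. The count in degree [t - i] is carried up to degree [t] by multiplying with the first
    [i] lines. *)
Lemma dimI_ge_red_vec (A : seq ('rV[K]_3 * nat)) Ls i t :
  (forall p, p \in unzip1 A -> p != 0) -> (forall L, L \in Ls -> L != 0) ->
  totally_reduces A Ls -> (i <= size Ls)%N -> (i <= t)%N ->
  ('C((t - i).+2, 2) <= dimI A t + sumn (drop i (red_vec A Ls)))%N.
Proof.
elim: i A Ls t => [|i IH] A Ls t A0 L0 AL.
  move=> _ _; rewrite drop0 subn0 sumn_red_vec //; apply: dimI_ge => pm pA.
  exact/A0/map_f.
case: Ls L0 AL => [//|L Ls] L0 AL; case: t => // t iL it.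
rewrite red_vec_cons /= subSS.
apply: leq_trans (IH (residual A L) Ls t _ _ _ _ _) _ => //.
- by rewrite unzip1_residual.
- by move=> M MLs; apply: L0; rewrite inE MLs orbT.
- by rewrite leq_add2r dimI_residual_le // L0 // inE eqxx.
Qed.

End Forms.

(** Unrolls [dimI_le_residual], ending with [dimI_le] when the lines run out and with [dimI0_le]
    when the degree does. The truncated subtractions are the positive parts in the bound. *)
Fixpoint reduction_bound (d : seq nat) (t : nat) : nat :=
  match d, t with
  | [::], _ => 'C(t.+2, 2)
  | e :: _, 0 => 1 - e
  | e :: d', t'.+1 => t'.+2 - e + reduction_bound d' t'
  end.

Lemma dimI_le_red_vec (K : closedFieldType) (A : seq ('rV[K]_3 * nat)) Ls t :
  distinct_points (unzip1 A) -> (forall L, L \in Ls -> L != 0) ->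
  (dimI A t <= reduction_bound (red_vec A Ls) t)%N.
Proof.
elim: Ls A t => [|L Ls IH] A t dA L0; first exact: dimI_le.
have L0' : L != 0 by rewrite L0 // inE eqxx.
rewrite red_vec_cons; case: t => [|t] /=; first exact: dimI0_le.
apply: leq_trans (dimI_le_residual t L0' dA) _; rewrite addnC leq_add2l IH //.
  by rewrite unzip1_residual.
by move=> M MLs; apply: L0; rewrite inE MLs orbT.
Qed.

(** * Binomial identities and the numerical use of GMS *)

Lemma binz_nat m n k : (n <= m)%N -> binz (m%:Z - n%:Z) k = 'C(m - n, k)%:Z.
Proof.
move=> nm; rewrite /binz subzn //; case: ltP => //.
by rewrite ltz_nat => h; rewrite bin_small.
Qed.

Lemma binz_lt a k : a < k%:Z -> binz a k = 0.
Proof. by rewrite /binz => ->. Qed.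

Lemma binz_shift2 t i : binz (t%:Z - i%:Z + 2) 2 = if (i <= t)%N then 'C((t - i).+2, 2)%:Z else 0.
Proof.
case: leqP => it; last by rewrite binz_lt //; lia.
by rewrite (_ : _ + 2 = t.+2%:Z - i%:Z) ?binz_nat ?subSn //; lia.
Qed.

Lemma binz1 (a : int) : binz a 1 = if 0 <= a then a else 0.
Proof. by rewrite /binz bin1; case: ifP; case: ifP; lia. Qed.

Lemma binz_pascal (a : int) : binz (a + 1) 2 = binz a 2 + binz a 1.
Proof.
case: (lerP 1 a) => a1; last by rewrite !binz_lt //; lia.
case: a a1 => // -[|n] // _; rewrite (_ : _ + 1 = n.+2%:Z - 0%N%:Z); last lia.
rewrite -[n.+1%:Z]subr0 -[0]/(0%N%:Z) !binz_nat // !subn0 binS; lia.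
Qed.

Lemma GMS_behead e d : GMS (e :: d) -> GMS d.
Proof. by move=> G i j ij jd; have := G i.+1 j.+1 ij jd; rewrite /=; lia. Qed.

Lemma reduction_boundE d t :
  (reduction_bound d t)%:Z = binz (t%:Z - (size d)%:Z + 2) 2
    + \sum_(i < size d) binz (t%:Z - i%:Z - (nth 0%N d i)%:Z + 1) 1.
Proof.
elim: d t => [|e d IH] [|t] /=.
- by rewrite big_ord0 addr0 binz_shift2.
- by rewrite big_ord0 addr0 binz_shift2 subn0.
(* In degree 0 every later summand has argument at most 0, so the early stop of the recursion loses
   nothing. *)
- rewrite binz_shift2 /= add0r big_ord_recl big1 ?addr0 /= => [|i _].
    by rewrite binz1; case: ifP; lia.
  by rewrite binz_lt // /bump; lia.
- rewrite PoszD IH big_ord_recl /= addrCA; congr (_ + _); first by congr binz; lia.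
  congr (_ + _); first by rewrite binz1; case: ifP; lia.
  by apply: eq_bigr => i _; rewrite /bump leq0n /= ?add0n; congr binz; lia.
Qed.

(** The hypothesis says that no subtraction truncates, so the entries of [d] cancel and Pascal's
    rule sums what is left. *)
Lemma reduction_bound_sumn d t :
  (forall j, (j < size d)%N -> (nth 0 d j + j <= t.+1)%N) ->
  (reduction_bound d t + sumn d)%N = 'C(t.+2, 2).
Proof.
elim: d t => [|e d IH] [|t] dt; rewrite ?addn0 //=; have := dt 0%N isT; rewrite /= => e0.
  (* In degree 0 the hypothesis forces all entries after the first to be 0. *)
  suff -> : sumn d = 0%N by rewrite binn; lia.
  apply/eqP; rewrite sumnE big_seq big1 // => x /(nthP 0%N)[j jd <-].
  by have := dt j.+1 jd; rewrite /=; lia.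
rewrite binS bin1 -(IH t); first lia.
by move=> j jd; have := dt j.+1 jd; rewrite /=; lia.
Qed.

(* GMS says that once some [t - i + 1 - d_i] is positive, all later ones are nonnegative,
   so from the first such index on the truncations in [reduction_bound] are exact. *)
Lemma reduction_bound_attained d t : GMS d ->
  exists2 i, (i <= size d)%N &
    (reduction_bound d t)%:Z = binz (t%:Z - i%:Z + 2) 2 - (sumn (drop i d))%:Z.
Proof.
elim: d t => [|e d IH] t G; first by exists 0%N; rewrite // binz_shift2 subn0 subr0.
(* GMS against the first entry gives [d_j + j <= e + 1 <= t + 1], with [j] counted from 0 in
   [e :: d], so nothing truncates and index 0 works. *)
have exact0 : (e <= t)%N -> exists2 i, (i <= size (e :: d))%N &
    (reduction_bound (e :: d) t)%:Z = binz (t%:Z - i%:Z + 2) 2 - (sumn (drop i (e :: d)))%:Z.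
  move=> et; exists 0%N => //; rewrite binz_shift2 subn0 drop0.
  rewrite -(@reduction_bound_sumn (e :: d)) /=; first lia.
  case=> [|j] jd /=; first lia.
  have [_ Gj] := G 0%N j.+1 isT jd.
  by have : j.+1%:Z - 0%N%:Z - 1 <= e%:Z - (nth 0%N d j)%:Z := Gj; lia.
(* If [e > t] the first term is truncated to 0, and the bound is that of the tail one degree lower.
   In degree 0 the whole bound is 0, attained at the last index. *)
have [/exact0//|et] := leqP e t; case: t {exact0} et => [|t] et.
  exists (size (e :: d)) => //; rewrite binz_shift2 /= drop_size /=; lia.
have [i id iE] := IH t (GMS_behead G); exists i.+1 => //=.
by rewrite (_ : _ - i.+1%:Z = t%:Z - i%:Z) -?iE; lia.
Qed.

Lemma hpE n d t i : size d = n.+1 -> (i <= n.+1)%N ->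
  hp n d t i = binz (t%:Z - i%:Z + 2) 2 - (sumn (drop i d))%:Z.
Proof.
move=> dn ni; congr (_ - _).
rewrite -(big_morph Posz PoszD (erefl _)); congr Posz.
rewrite sumnE [RHS](big_nth 0%N) size_drop dn -{1}[i]add0n big_addn.
by apply: eq_bigr => j _; rewrite nth_drop addnC.
Qed.

Lemma Fv_hmax n d t : Fv n d t = binz (t%:Z + 2) 2 - hmax n d t.
Proof.
have FtermE i : Fterm n d t i = binz (t%:Z + 2) 2 - hp n d t i.
  by rewrite /Fterm /hp opprD opprK [RHS]addrA.
rewrite /Fv /hmax (@big_morph _ _ (fun x => binz (t%:Z + 2) 2 - x)
  (Fterm n d t n.+1) Num.min (hp n d t n.+1) Num.max) //.
  by apply: eq_bigr => i _; rewrite FtermE.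
by move=> x y; rewrite /Order.max /Order.min; do 2 case: ifP; lia.
Qed.

(** With [a = t - i + 1] and [d_i >= 0], the positive part of [min(a, d_i)] is that of [a] minus
    that of [a - d_i]; the positive parts of [a] sum by Pascal's rule. *)
Lemma fvE n d t :
  fv n d t = binz (t%:Z + 2) 2 - (binz (t%:Z - n%:Z + 1) 2
      + \sum_(i < n.+1) binz (t%:Z - i%:Z - (nth 0%N d i)%:Z + 1) 1).
Proof.
have S : binz (t%:Z + 2) 2
    = binz (t%:Z - n%:Z + 1) 2 + \sum_(i < n.+1) binz (t%:Z - i%:Z + 1) 1.
  elim: n => [|n IH]; rewrite big_ord_recr /=.
    by rewrite big_ord0 add0r subr0 -binz_pascal -addrA.
  rewrite IH [RHS]addrCA [LHS]addrC; congr (_ + _).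
  rewrite (_ : t%:Z - n%:Z + 1 = t%:Z - n.+1%:Z + 1 + 1) ?binz_pascal //; lia.
rewrite S opprD addrACA subrr add0r -sumrB; apply: eq_bigr => i _.
by rewrite !binz1 /Order.min; do 4?case: ifP; lia.
Qed.

Theorem theorem2p2p2 (K : closedFieldType) (Z : seq ('rV[K]_3 * nat))
  (n : nat) (Ls : seq 'rV[K]_3) :
  fat_point_scheme Z -> size Ls = n.+1 -> lines_ok Ls ->
  totally_reduces Z Ls -> GMS (red_vec Z Ls) ->
  forall t : nat,
    hmax n (red_vec Z Ls) t =
      binz (t%:Z - n%:Z + 1) 2
      + \sum_(i < n.+1) binz (t%:Z - i%:Z - (nth 0%N (red_vec Z Ls) i)%:Z + 1) 1
    /\ (dimI Z t)%:Z = hmax n (red_vec Z Ls) t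
    /\ (hilb Z t)%:Z = fv n (red_vec Z Ls) t
    /\ fv n (red_vec Z Ls) t = Fv n (red_vec Z Ls) t.
Proof.
move=> /fat_point_scheme_distinct dZ sL okL redL; set d := red_vec Z Ls => Gd t.
have [_ Z0 _] := dZ.
have L0 L : L \in Ls -> L != 0 by move=> /(nthP 0)[i iL <-]; apply: okL.
have sd : size d = n.+1 by rewrite size_red_vec.
have up : (dimI Z t)%:Z <= (reduction_bound d t)%:Z by rewrite lez_nat dimI_le_red_vec.
have low : hmax n d t <= (dimI Z t)%:Z.
  have hi i : (i <= n.+1)%N -> hp n d t i <= (dimI Z t)%:Z.
    (* For [i > t] the binomial is 0, so this term is at most 0. *)
    move=> ni; rewrite hpE // binz_shift2; case: ifP => it; last lia.
    by have := @dimI_ge_red_vec _ Z Ls i t Z0 L0 redL; rewrite sL -/d => /(_ ni it); lia.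
  by apply: bigmax_le => [|i _]; apply: hi; rewrite // -ltnS.
have att : (reduction_bound d t)%:Z <= hmax n d t.
  have [i] := reduction_bound_attained t Gd; rewrite sd => ni ->; rewrite -(hpE t sd ni).
  by apply: (le_bigmax _ (fun i : 'I_n.+2 => hp n d t i) (Ordinal (ni : i < n.+2)%N)).
have dE : (dimI Z t)%:Z = hmax n d t by apply/le_anti; rewrite low (le_trans up att).
have hE : hmax n d t = (reduction_bound d t)%:Z.
  by apply/le_anti; rewrite att (le_trans low up).
have bE : hmax n d t = binz (t%:Z - n%:Z + 1) 2
    + \sum_(i < n.+1) binz (t%:Z - i%:Z - (nth 0%N d i)%:Z + 1) 1.
  rewrite hE reduction_boundE sd; congr (binz _ _ + _); lia.
split=> //; split=> //; rewrite fvE -bE Fv_hmax; split=> //.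
(* The subtraction in [hilb] is exact because [dimI] is at most the number of monomials. *)
have := dimI_le Z t; rewrite /hilb -dE -[t%:Z]subr0 -[0]/(0%N%:Z) binz_shift2 subn0 size_mons.
by move=> le; rewrite -subzn.
Qed.
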